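(* Let $L\subset\mathbb{R}^n$ be an $n$-dimensional lattice with structure matrix $A$, and let $a_1,\dots,a_n$ be the column vectors of $A$. If the ratios $$\frac{(a_j,a_i)}{(a_k,a_k)},\qquad 1\le i,j,k\le n,$$ are all rational, then $OC(L)$ is generated by the reflections defined by the nonzero vectors of $L$.
   Context: $\mathbb{R}^n$ carries the standard inner product $(\cdot,\cdot)$ and canonical basis $(e_1,\dots,e_n)$. The $n$-dimensional lattice $L\subset\mathbb{R}^n$ with structure matrix $A$ (a non-singular real $n\times n$ matrix) is the lattice $L=\bigoplus_{i=1}^n\mathbb{Z}a_i$ with basis $(a_1,\dots,a_n)=(e_1,\dots,e_n)A$, i.e. the $a_i$ are the columns of $A$. Let $O(n)$ be the group of orthogonal transformations of $\mathbb{R}^n$. The coincidence isometry group of $L$ is $OC(L)=\{\mathcal{R}\in O(n): [L:L\cap\mathcal{R}L]<\infty\}$, a group under composition. For nonzero $v\in\mathbb{R}^n$, the reflection defined by $v$ is $\mathcal{R}_v(x)=x-\frac{2(x,v)}{(v,v)}v$ for $x\in\mathbb{R}^n$. *)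

(* Defs.v *)
From HB Require Import structures.
From mathcomp Require Import all_boot all_order all_algebra.
From mathcomp Require Import boolp classical_sets functions cardinality reals.
Set Implicit Arguments.
Unset Strict Implicit.
Unset Printing Implicit Defensive.
Import Order.TTheory GRing.Theory Num.Theory.
Local Open Scope classical_set_scope.
Local Open Scope ring_scope.

Definition dot (R : realType) (n : nat) (x y : 'cV[R]_n) : R :=
  \sum_(i < n) x i 0 * y i 0.

(* The sum is direct because A is assumed invertible wherever this is used. *)
Definition lattice (R : realType) (n : nat) (A : 'M[R]_n) : set 'cV[R]_n :=
  [set x : 'cV[R]_n | exists z : 'I_n -> int, x = \sum_(i < n) col i A *~ z i].

Definition orthogonal_group (R : realType) (n : nat) :
    set ('cV[R]_n -> 'cV[R]_n) :=
  [set f : 'cV[R]_n -> 'cV[R]_n | linear f /\ forall x y,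
     dot (f x) (f y) = dot x y].

(* [L : H] < oo for an additive subgroup H of L: the set of the cosets x + H,
   for x in L, is finite. *)
Definition finite_index (V : zmodType) (L H : set V) : Prop :=
  finite_set [set [set x + h | h in H] | x in L].

Definition coincidence_group (R : realType) (n : nat) (L : set 'cV[R]_n) :
    set ('cV[R]_n -> 'cV[R]_n) :=
  [set f | @orthogonal_group R n f /\ finite_index L (L `&` f @` L)].

Definition reflection (R : realType) (n : nat) (v x : 'cV[R]_n) : 'cV[R]_n :=
  x - (2 * dot x v / dot v v) *: v.

Definition lattice_reflections (R : realType) (n : nat) (L : set 'cV[R]_n) :
    set ('cV[R]_n -> 'cV[R]_n) :=
  [set reflection v | v in [set v | L v /\ v != 0]].

(* Inverses are two-sided inverse functions. *)
Definition orthogonal_subgroup (R : realType) (n : nat)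
    (G : set ('cV[R]_n -> 'cV[R]_n)) : Prop :=
  [/\ G `<=` @orthogonal_group R n,
      G idfun,
      forall f g, G f -> G g -> G (f \o g) &
      forall f g, G f -> cancel f g -> cancel g f -> G g].

(* Only meaningful for S included in the orthogonal group: otherwise no
   subgroup contains S and the intersection is the set of all functions. *)
Definition generated_group (R : realType) (n : nat)
    (S : set ('cV[R]_n -> 'cV[R]_n)) : set ('cV[R]_n -> 'cV[R]_n) :=
  smallest (@orthogonal_subgroup R n) S.

Definition is_rational (R : realType) (x : R) : Prop :=
  exists q : rat, x = ratr q.

(* Main.v *)
From HB Require Import structures.
Require Import Defs.
From mathcomp Require Import all_boot all_order all_algebra.
From mathcomp Require Import boolp classical_sets functions cardinality reals.
From mathcomp Require Import ring.
Local Open Scope ring_scope.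

(** Let V be the rational span of the columns of A.  Two facts give the theorem.

    An orthogonal map f is a coincidence isometry exactly when f maps V into
    itself [coincidence_groupE].  If the index is finite, then some positive
    multiple of each a_j lies in f L [finite_index_multiple], so the matrix of
    the inverse of f in the basis (a_j) is rational, and so is that of f.
    Conversely, if this matrix is rational, clearing the denominators of its
    inverse gives m > 0 with m L inside f L, and L / m L is finite
    [finite_index_lattice].

    The hypothesis on the ratios makes the inner product on V a real multiple of
    a rational form [dot_rational], so that reflections in vectors of V preserve
    V.  Since the form is positive definite, the Cartan-Dieudonne argument works
    over the rationals with no isotropic vector to avoid: if f preserves V,
    fixes some of the a_i and moves a further a_k, then v = f a_k - a_k is a
    nonzero vector of V orthogonal to all the fixed a_i, and the reflection
    defined by v sends f a_k back to a_k [reflection_swap].  Composing f with it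
    fixes one more column, and after at most n steps the identity is reached
    [stabilizer_generated].  A reflection does not see the length of its vector,
    and every vector of V has a nonzero multiple in L, so the reflections used
    are defined by vectors of L. *)

Set Implicit Arguments.
Unset Strict Implicit.
Unset Printing Implicit Defensive.
Import Order.TTheory GRing.Theory Num.Theory.
Local Open Scope classical_set_scope.

(** * Orthogonal maps and reflections *)

Section Orthogonal.
Variables (R : realType) (n : nat).
Implicit Types (x y z v : 'cV[R]_n) (f g : 'cV[R]_n -> 'cV[R]_n).

Lemma dotE x y : dot x y = (x^T *m y) 0 0.
Proof. by rewrite mxE; apply: eq_bigr => i _; rewrite mxE. Qed.

Lemma dotC x y : dot x y = dot y x.
Proof. by apply: eq_bigr => i _; rewrite mulrC. Qed.

Lemma dotDl x y z : dot (x + y) z = dot x z + dot y z.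
Proof. by rewrite !dotE linearD mulmxDl mxE. Qed.

Lemma dotZl a x y : dot (a *: x) y = a * dot x y.
Proof. by rewrite !dotE linearZ -scalemxAl mxE. Qed.

Lemma dotDr x y z : dot x (y + z) = dot x y + dot x z.
Proof. by rewrite dotC dotDl !(dotC x). Qed.

Lemma dotZr a x y : dot x (a *: y) = a * dot x y.
Proof. by rewrite dotC dotZl dotC. Qed.

Lemma dotBl x y z : dot (x - y) z = dot x z - dot y z.
Proof. by rewrite -scaleN1r dotDl dotZl mulN1r. Qed.

Lemma dotBr x y z : dot x (y - z) = dot x y - dot x z.
Proof. by rewrite dotC dotBl !(dotC x). Qed.

Lemma dot_eq0 x : (dot x x == 0) = (x == 0).
Proof.
apply/idP/eqP => [|->]; last first.
  by rewrite /dot big1 // => i _; rewrite mxE mul0r.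
rewrite /dot psumr_eq0 => [/allP x0|i _]; last by rewrite -expr2 sqr_ge0.
apply/colP => i; rewrite mxE; apply/eqP.
by have := x0 i (mem_index_enum i); rewrite mulf_eq0 orbb.
Qed.

Lemma linear_mulmxP f : linear f -> exists F : 'M[R]_n, f = mulmx F.
Proof.
move=> lf; pose h : {linear _ -> _} := HB.pack f (GRing.isLinear.Build _ _ _ _ f lf).
exists (\matrix_(i, j) f (delta_mx j 0) i 0); apply/funext => x.
rewrite -[f]/(h : _ -> _) {1}[x]matrix_sum_delta linear_sum.
apply/colP => i; rewrite summxE mxE; apply: eq_bigr => j _.
by rewrite big_ord1 linearZ !mxE mulrC.
Qed.

Lemma orthogonal_groupE f :
  orthogonal_group f <-> exists2 F : 'M[R]_n, F^T *m F = 1%:M & f = mulmx F.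
Proof.
split=> [[/linear_mulmxP[F ->] orthF]|[F FF ->]]; last first.
  split=> [a u v|x y]; first by rewrite mulmxDr -scalemxAr.
  by rewrite !dotE trmx_mul mulmxA -(mulmxA x^T) FF mulmx1.
exists F => //; apply/matrixP => i j.
have := orthF (delta_mx i 0) (delta_mx j 0).
rewrite !dotE trmx_mul mulmxA -(mulmxA _ F^T) trmx_delta -rowE -colE.
rewrite mul_delta_mx_cond 2!mxE => ->.
by rewrite [RHS]mxE; case: (i == j); rewrite mxE.
Qed.

Lemma orthogonal_subgroup_orthogonal : orthogonal_subgroup (@orthogonal_group R n).
Proof.
split=> //= [f g [lf df] [lg dg]|f g [lf df] fK gK].
  by split=> [a u v|x y] /=; rewrite ?lg ?lf ?df ?dg.
split=> [a u v|x y]; last by rewrite -df !gK.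
by apply: (can_inj fK); rewrite lf !gK.
Qed.

Lemma reflection_orthogonal v : v != 0 -> orthogonal_group (reflection v).
Proof.
rewrite -dot_eq0 => v0; split=> [a x y|x y]; rewrite /reflection.
  rewrite dotDl dotZl mulrDr mulrDl scalerDl scalerBr scalerA opprD addrACA.
  by congr (_ - _ *: _ + _); rewrite mulrCA !mulrA.
rewrite !(dotBl, dotBr, dotZl, dotZr) (dotC v y).
by field.
Qed.

Lemma reflectionZ c v : c != 0 -> reflection (c *: v) = reflection v.
Proof.
move=> c0; have [->|v0] := eqVneq v 0; first by rewrite scaler0.
apply/funext => x; rewrite /reflection scalerA !(dotZl, dotZr).
by congr (_ - _ *: _); rewrite -dot_eq0 in v0; field; rewrite c0 v0.
Qed.

Lemma reflection_fix v x : dot x v = 0 -> reflection v x = x.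
Proof. by move=> xv; rewrite /reflection xv mulr0 mul0r scale0r subr0. Qed.

Lemma reflectionK v : v != 0 -> involutive (reflection v).
Proof.
rewrite -dot_eq0 => v0 x; rewrite /reflection !(dotBl, dotZl).
rewrite -addrA -opprD -scalerDl -[RHS]subr0 -(scale0r v).
by congr (_ - _ *: _); field.
Qed.

Lemma reflection_swap x y :
  x != y -> dot x x = dot y y -> reflection (x - y) x = y.
Proof.
rewrite -subr_eq0 -dot_eq0 => xy0 dxy; rewrite /reflection.
(* Equal norms make dot x (x - y) half of dot (x - y) (x - y). *)
have <- : dot (x - y) (x - y) = 2 * dot x (x - y).
  by rewrite !(dotBl, dotBr) -dxy (dotC y x); ring.
by rewrite divff // scale1r opprB addrC subrK.
Qed.

End Orthogonal.

(** * Subgroups of finite index *)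

Section FiniteIndex.
Variable V : zmodType.
Implicit Types (x y : V) (L H : set V).

Definition subgroup_closed H := H 0 /\ forall x y, H x -> H y -> H (x - y).

Lemma subgroup_closedN H x : subgroup_closed H -> H x -> H (- x).
Proof. by move=> [H0 HB] Hx; rewrite -sub0r; apply: HB. Qed.

Lemma subgroup_closedMn H x k : subgroup_closed H -> H x -> H (x *+ k).
Proof.
move=> Hsub Hx; elim: k => [|k IHk]; first by rewrite mulr0n; case: Hsub.
rewrite mulrSr -[x in _ + x]opprK; case: (Hsub) => _; apply=> //.
exact: subgroup_closedN.
Qed.

Lemma subgroup_closedI L H :
  subgroup_closed L -> subgroup_closed H -> subgroup_closed (L `&` H).
Proof.
move=> [L0 LB] [H0 HB]; split=> // x y [Lx Hx] [Ly Hy].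
by split; [apply: LB|apply: HB].
Qed.

Lemma coset_eqP H x y : subgroup_closed H ->
  [set x + h | h in H] = [set y + h | h in H] <-> H (x - y).
Proof.
move=> Hsub; have [H0 HB] := Hsub; split=> [xyH|Hxy].
  have : [set x + h | h in H] x by exists 0; rewrite ?addr0.
  by rewrite xyH => -[h Hh <-]; rewrite addrC addKr.
apply/seteqP; split=> _ [h Hh <-].
  exists (h - (y - x)); last by rewrite opprB addrCA [y + _]addrC subrK addrC.
  by apply: HB => //; rewrite -opprB; apply: subgroup_closedN.
exists (h - (x - y)); last by rewrite opprB addrCA [x + _]addrC subrK addrC.
exact: HB.
Qed.

(** There are infinitely many multiples of x and finitely many cosets of H, so
    two multiples lie in the same coset; their difference is in H. *)
Lemma finite_index_multiple L H x :
    subgroup_closed L -> subgroup_closed H -> finite_index L H -> L x ->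
  exists2 m, (0 < m)%N & H (x *+ m).
Proof.
move=> Lsub Hsub Lfin Lx.
pose c k := [set x *+ k + h | h in H].
have cfin : finite_set (range c).
  apply: sub_finite_set Lfin => _ [k _ <-].
  by exists (x *+ k) => //; apply: subgroup_closedMn.
have collision k l : (k < l)%N -> c k = c l -> exists2 m, (0 < m)%N & H (x *+ m).
  move=> kl ckl; exists (l - k)%N; first by rewrite subn_gt0.
  by rewrite mulrnBr ?(ltnW kl) //; apply/coset_eqP.
apply: contrapT => noH; apply: infinite_nat.
rewrite -(eq_finite_set (inj_card_eq (f := c) _)) // => k l _ _ ckl.
by case: (ltngtP k l) => // [/collision|/collision] hc; case: noH; apply: hc.
Qed.

End FiniteIndex.

(** * A lattice and its rational span *)

Section Lattice.
Variables (R : realType) (n : nat) (A : 'M[R]_n).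
Implicit Types (x y z v : 'cV[R]_n) (f g : 'cV[R]_n -> 'cV[R]_n).

Definition rational_span : set 'cV[R]_n :=
  [set x | exists q : 'cV[rat]_n, x = A *m map_mx ratr q].

Lemma latticeE x :
  lattice A x <-> exists z : 'cV[int]_n, x = A *m map_mx intr z.
Proof.
have comb (z : 'I_n -> int) :
    \sum_(i < n) col i A *~ z i = A *m map_mx intr (\col_i z i).
  apply/colP => i; rewrite summxE !mxE; apply: eq_bigr => j _.
  by rewrite -scaler_int !mxE mulrC.
split=> [[z ->]|[z ->]]; first by exists (\col_i z i).
exists (fun i => z i 0); rewrite comb.
by congr (_ *m map_mx _ _); apply/colP => i; rewrite mxE.
Qed.

Lemma lattice_subgroup : subgroup_closed (lattice A).
Proof.
split=> [|x y]; first by apply/latticeE; exists 0; rewrite map_mx0 mulmx0.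
move=> /latticeE[z ->] /latticeE[w ->]; apply/latticeE.
by exists (z - w); rewrite map_mxB mulmxBr.
Qed.

Lemma image_lattice_subgroup f :
  orthogonal_group f -> subgroup_closed (f @` lattice A).
Proof.
move=> /orthogonal_groupE[F _ ->]; have [L0 LB] := lattice_subgroup.
split=> [|_ _ [x Lx <-] [y Ly <-]]; first by exists 0; rewrite ?mulmx0.
by exists (x - y); [apply: LB|rewrite mulmxBr].
Qed.

Lemma col_lattice i : lattice A (col i A).
Proof.
by apply/latticeE; exists (delta_mx i 0); rewrite map_delta_mx colE.
Qed.

Lemma ratr_intr_mx m (z : 'M[int]_(n, m)) :
  map_mx ratr (map_mx intr z : 'M[rat]_(n, m)) = map_mx intr z :> 'M[R]_(n, m).
Proof. by rewrite -map_mx_comp; apply: eq_map_mx => k /=; rewrite ratr_int. Qed.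

Lemma lattice_rational_span : lattice A `<=` rational_span.
Proof. by move=> x /latticeE[z ->]; exists (map_mx intr z); rewrite ratr_intr_mx. Qed.

Lemma rational_spanD x y :
  rational_span x -> rational_span y -> rational_span (x + y).
Proof. by move=> [p ->] [q ->]; exists (p + q); rewrite map_mxD mulmxDr. Qed.

Lemma rational_spanZ r x : rational_span x -> rational_span (ratr r *: x).
Proof. by move=> [q ->]; exists (r *: q); rewrite map_mxZ scalemxAr. Qed.

Lemma rational_spanB x y :
  rational_span x -> rational_span y -> rational_span (x - y).
Proof.
move=> Vx Vy; apply: rational_spanD => //.
by rewrite -scaleN1r -(rmorphN1 ratr); apply: rational_spanZ.
Qed.

Lemma common_denominator m (M : 'M[rat]_(n, m)) :
  exists2 d : nat, (0 < d)%N & exists z : 'M[int]_(n, m), M *+ d = map_mx intr z.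
Proof.
pose den p := `|denq (M p.1 p.2)|%N; pose d := (\prod_p den p)%N.
exists d; first by apply/prodn_gt0 => p; rewrite absz_gt0 denq_neq0.
exists (\matrix_(i, j) (numq (M i j) * (d %/ den (i, j))%N)).
apply/matrixP => i j; rewrite mulmxnE !mxE -mulr_natr.
have /divnK {1}<- : (den (i, j) %| d)%N by rewrite /d (bigD1 (i, j)) ?dvdn_mulr.
rewrite intrM numqE mulnC natrM mulrA; congr (_ * _ * _).
by rewrite -[LHS]/((den (i, j))%:Z%:~R) gez0_abs.
Qed.

Lemma rational_span_lattice x :
  rational_span x -> exists2 d : nat, (0 < d)%N & lattice A (d%:R *: x).
Proof.
move=> [q ->]; have [d d0 [z zE]] := common_denominator q.
exists d => //; apply/latticeE; exists z.
by rewrite -ratr_intr_mx -zE raddfMn /= -scaler_nat scalemxAr.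
Qed.

(** An element of the lattice is determined modulo m L by its coordinates
    modulo m. *)
Lemma finite_index_lattice m (H : set 'cV[R]_n) :
    (0 < m)%N -> subgroup_closed H ->
    (forall x, lattice A x -> H (x *+ m)) ->
  finite_index (lattice A) H.
Proof.
move=> m0 Hsub mLH.
pose c (r : {ffun 'I_n -> 'I_m}) :=
  [set A *m map_mx intr (\col_i (r i : int)) + h | h in H].
have : finite_set (range c) by apply/finite_image/finite_finset.
apply: sub_finite_set => _ [x /latticeE[z ->] <-].
have rm i : (`|(z i 0%R %% m)%Z| < m)%N.
  by rewrite -ltz_nat gez0_abs ?modz_ge0 ?ltz_pmod // -lt0n.
exists [ffun i => Ordinal (rm i)] => //; apply/esym/(coset_eqP _ _ Hsub).
rewrite -mulmxBr -map_mxB.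
rewrite (_ : z - _ = (\col_i (z i 0%R %/ m)%Z) *+ m).
  rewrite raddfMn /= -scaler_nat -scalemxAr scaler_nat; apply: mLH.
  by apply/latticeE; eexists.
apply/colP => i; rewrite mulmxnE !mxE ffunE /= gez0_abs ?modz_ge0 -?lt0n //.
by rewrite {1}(divz_eq (z i 0) m) addrK -mulr_natr natz.
Qed.

(** * Coincidence isometries preserve the rational span *)

Definition span_stabilizer : set ('cV[R]_n -> 'cV[R]_n) :=
  [set f | orthogonal_group f /\ forall x, rational_span x -> rational_span (f x)].

Lemma rational_matrix f : orthogonal_group f ->
    (forall j, rational_span (f (col j A))) ->
  exists M : 'M[rat]_n, forall x, f (A *m x) = A *m (map_mx ratr M *m x).
Proof.
move=> /orthogonal_groupE[F _ ->] /choice[q qE].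
exists (\matrix_(i, j) q j i 0) => x.
rewrite !mulmxA; congr (_ *m x); apply/matrixP => i j.
have /colP/(_ i) := qE j; rewrite colE mulmxA -colE !mxE => ->.
by apply: eq_bigr => k _; rewrite !mxE.
Qed.

Lemma span_stabilizer_col f : orthogonal_group f ->
  (forall j, rational_span (f (col j A))) -> span_stabilizer f.
Proof.
move=> orthf /(rational_matrix orthf)[M fA]; split=> // _ [q ->].
by rewrite fA; exists (M *m q); rewrite map_mxM.
Qed.

Hypothesis A_unit : A \in unitmx.

(** The matrix of f in the basis of columns is conjugate to an orthogonal one,
    hence invertible, and the inverse of a rational matrix is rational. *)
Lemma span_stabilizer_inverse f : span_stabilizer f ->
  exists N : 'M[rat]_n, forall x, f (A *m (map_mx ratr N *m x)) = A *m x.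
Proof.
move=> Sf; have [orthf _] := Sf; have /orthogonal_groupE[F FF fF] := orthf.
have [|M fA] := rational_matrix orthf.
  by move=> j; apply/Sf.2/lattice_rational_span/col_lattice.
have MF : F *m A = A *m map_mx ratr M.
  apply/matrixP => i j; have := fA (delta_mx j 0).
  by rewrite fF !mulmxA -!colE => /colP/(_ i); rewrite ![col _ _ _ _]mxE.
have : map_mx (@ratr R) M \in unitmx.
  have -> : map_mx ratr M = invmx A *m (F *m A) :> 'M[R]_n by rewrite MF mulKmx.
  by rewrite !unitmx_mul unitmx_inv A_unit (mulmx1_unit FF).2.
rewrite map_unitmx => uM; exists (invmx M) => x.
by rewrite fA mulmxA -map_mxM mulmxV // map_mx1 mul1mx.
Qed.

Lemma span_stabilizer_subgroup : orthogonal_subgroup span_stabilizer.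
Proof.
have [_ o1 oM oV] := orthogonal_subgroup_orthogonal R n.
split=> [f []|//|f g [orthf Vf] [orthg Vg]|f g Sf fK gK] //.
  by split=> [|x Vx]; [apply: oM|apply/Vf/Vg].
have [orthf _] := Sf; split=> [|_ [q ->]]; first exact: (oV f).
have [N fN] := span_stabilizer_inverse Sf.
by rewrite -fN fK; exists (N *m q); rewrite map_mxM.
Qed.

Lemma coincidence_groupE : coincidence_group (lattice A) = span_stabilizer.
Proof.
have Lsub := lattice_subgroup.
apply/seteqP; split=> [f [orthf fin]|f Sf].
- have Hsub := subgroup_closedI Lsub (image_lattice_subgroup orthf).
  have [_ _ _ stabV] := span_stabilizer_subgroup.
  have /orthogonal_groupE[F FF fF] := orthf.
  have fK : cancel f (mulmx F^T) by move=> x; rewrite fF mulmxA FF mul1mx.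
  have gK : cancel (mulmx F^T) f.
    by move=> x; rewrite fF mulmxA (mulmx1C FF) mul1mx.
  have [_ _ _ orthV] := orthogonal_subgroup_orthogonal R n.
  have orthg := orthV f _ orthf fK gK.
  (* If m a_j = f x with x in L, then the inverse of f maps a_j to x / m. *)
  apply: (stabV _ _ _ gK fK).
  apply: span_stabilizer_col orthg _ => j.
  have [m m0 [_ [x Lx fx]]] := finite_index_multiple Lsub Hsub fin (col_lattice j).
  have -> : F^T *m col j A = ratr m%:R^-1 *: x.
    rewrite -[x in RHS]fK fx -scaler_nat -scalemxAr scalerA fmorphV rmorph_nat.
    by rewrite mulVf ?scale1r // pnatr_eq0 -lt0n.
  exact/rational_spanZ/lattice_rational_span.
- have [orthf _] := Sf; split=> //.
  have [N fN] := span_stabilizer_inverse Sf.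
  have [d d0 [z zE]] := common_denominator N.
  apply: (finite_index_lattice d0); first exact/subgroup_closedI/image_lattice_subgroup.
  move=> x Lx; split; first exact: subgroup_closedMn.
  have /latticeE[w ->] := Lx.
  exists (A *m map_mx intr (z *m w)); first by apply/latticeE; exists (z *m w).
  rewrite map_mxM -(ratr_intr_mx z) -zE raddfMn /= -!scaler_nat.
  by rewrite -scalemxAl scalemxAr fN scalemxAr.
Qed.

End Lattice.

(** * Generation by lattice reflections *)

Section Generation.
Variables (R : realType) (n : nat) (A : 'M[R]_n).
Implicit Types (x y z v : 'cV[R]_n) (f g : 'cV[R]_n -> 'cV[R]_n).
Hypothesis A_unit : A \in unitmx.
Hypothesis rational_ratios : forall i j k : 'I_n,
  is_rational (dot (col j A) (col i A) / dot (col k A) (col k A)).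

(** Take for c the squared length of one column: the ratios with denominator c
    are the entries of c^-1 times the Gram matrix of A. *)
Lemma dot_rational : exists2 c : R, c != 0 & forall x y,
  rational_span A x -> rational_span A y -> exists r, dot x y = c * ratr r.
Proof.
have [k _|noidx] := pickP 'I_n; last first.
  exists 1; rewrite ?oner_eq0 // => x y _ _; exists 0.
  by rewrite rmorph0 mulr0 /dot big1 // => i; have := noidx i.
pose c := dot (col k A) (col k A).
have c0 : c != 0.
  rewrite dot_eq0; apply/eqP => Ak0.
  have : delta_mx k 0 = 0 :> 'cV[R]_n.
    by rewrite -[LHS](mulKmx A_unit) -colE Ak0 mulmx0.
  by move/colP/(_ k); rewrite !mxE !eqxx => /eqP; rewrite oner_eq0.
exists c => // _ _ [p ->] [q ->].
have /choice[Q QE] : forall ij : 'I_n * 'I_n,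
    exists r, dot (col ij.1 A) (col ij.2 A) = c * ratr r.
  move=> [i j]; have [r rE] := rational_ratios j i k; exists r.
  by rewrite -rE mulrCA divff // mulr1.
have gram : A^T *m A = c *: map_mx ratr (\matrix_(i, j) Q (i, j)).
  apply/matrixP => i j; rewrite !mxE -QE.
  by apply: eq_bigr => l _; rewrite !mxE.
exists ((p^T *m (\matrix_(i, j) Q (i, j)) *m q) 0 0).
rewrite dotE trmx_mul mulmxA -(mulmxA _ A^T) gram -scalemxAr -scalemxAl mxE.
by rewrite map_trmx -!map_mxM mxE.
Qed.

Lemma reflection_span_stabilizer v :
  rational_span A v -> v != 0 -> span_stabilizer A (reflection v).
Proof.
move=> Vv v0; split=> [|x Vx]; first exact: reflection_orthogonal.
have [c c0 dotV] := dot_rational.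
have [[r xv] [s vv]] := (dotV x v Vx Vv, dotV v v Vv Vv).
apply: rational_spanB => //.
suff -> : 2 * dot x v / dot v v = ratr (2 * r / s) by apply: rational_spanZ.
by rewrite xv vv fmorph_div rmorphM rmorph_nat mulrCA invfM mulrACA divff // mul1r.
Qed.

Section SubgroupWithReflections.
Variable G : set ('cV[R]_n -> 'cV[R]_n).
Hypothesis G_subgroup : orthogonal_subgroup G.
Hypothesis G_reflections : lattice_reflections (lattice A) `<=` G.

Lemma span_reflection v : rational_span A v -> v != 0 -> G (reflection v).
Proof.
move=> /rational_span_lattice[d d0 Ldv] v0.
have d0' : d%:R != 0 :> R by rewrite pnatr_eq0 -lt0n.
rewrite -(reflectionZ _ d0'); apply: G_reflections.
by exists (d%:R *: v); rewrite // /mkset scaler_eq0 negb_or d0'.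
Qed.

(** Induction on the number d of columns that f may still move: composing with
    the reflection in f a - a, for a the last of them, makes f fix a as well. *)
Lemma stabilizer_generated_fixing d f :
    span_stabilizer A f -> (forall i : 'I_n, (d <= i)%N -> f (col i A) = col i A) ->
  G f.
Proof.
have [_ G1 GM _] := G_subgroup.
elim: d f => [|d IHd] f Sf fA.
  suff -> : f = idfun by [].
  have [/orthogonal_groupE[F _ fF] _] := Sf.
  suff F1 : F = 1%:M by apply/funext => x; rewrite fF F1 mul1mx.
  suff FA : F *m A = A by rewrite -[F](mulmxK A_unit) FA mulmxV.
  apply/matrixP => i j; have /colP/(_ i) := fA j (leq0n j).
  by rewrite fF colE mulmxA -!colE !mxE.
have [dn|nd] := ltnP d n; last first.
  by apply: IHd => // i di; have := leq_trans nd di; rewrite leqNgt ltn_ord.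
set a := col (Ordinal dn) A.
have [fa|fa] := eqVneq (f a) a.
  apply: IHd => // i; rewrite leq_eqVlt => /orP[/eqP di|]; last exact: fA.
  by rewrite (_ : i = Ordinal dn) //; apply: val_inj.
have [orthf Vf] := Sf; have [_ df] := orthf.
have v0 : f a - a != 0 by rewrite subr_eq0.
have Vv : rational_span A (f a - a).
  have Va : rational_span A a by apply/lattice_rational_span/col_lattice.
  by apply: rational_spanB => //; apply: Vf.
have Grefl := span_reflection Vv v0.
have -> : f = reflection (f a - a) \o (reflection (f a - a) \o f).
  by apply/funext => x /=; rewrite reflectionK.
apply: (GM _ _ Grefl); apply: IHd.
  have [_ _ SM _] := span_stabilizer_subgroup A_unit.
  exact/SM/Sf/reflection_span_stabilizer.
move=> i; rewrite leq_eqVlt => /orP[/eqP di|di] /=.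
  by rewrite (_ : i = Ordinal dn) ?reflection_swap ?df //; apply: val_inj.
(* A vector x fixed by f is orthogonal to f a - a, as (x, f a) = (f x, f a). *)
rewrite (fA i di) reflection_fix // dotBr.
by rewrite -[dot _ (f a)](congr1 (fun x => dot x (f a)) (fA i di)) df subrr.
Qed.

Lemma stabilizer_generated : span_stabilizer A `<=` G.
Proof.
move=> f Sf; apply: (@stabilizer_generated_fixing n) => // i.
by rewrite leqNgt ltn_ord.
Qed.

End SubgroupWithReflections.
End Generation.

Theorem theorem3p3 (R : realType) (n : nat) (A : 'M[R]_n)
  (A_nonsingular : A \in unitmx)
  (rational_ratios : forall i j k : 'I_n,
     is_rational (dot (col j A) (col i A) / dot (col k A) (col k A))) :
  coincidence_group (lattice A)
  = generated_group (lattice_reflections (lattice A)).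
Proof.
rewrite coincidence_groupE //; apply/seteqP; split.
  by move=> f Sf G [Gsub Grefl]; apply: (stabilizer_generated _ _ Gsub Grefl).
apply: smallest_sub; first exact: span_stabilizer_subgroup.
move=> _ [v [Lv v0] <-]; apply: reflection_span_stabilizer => //.
exact: lattice_rational_span.
Qed.
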